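(* Define integers $F'(n)$ and $G'(n)$, $n\ge 1$, by \[ \sum_{n=1}^\infty F'(n) q^n := \sum_{n=1}^\infty q^{n}(q^{n+1};q)_\infty (q^{n};q)_{n},\qquad \sum_{n=1}^\infty G'(n) q^n := \sum_{n=1}^\infty q^{n}(q^{n+1};q)_\infty (-q^{n};q)_{n}. \] Then \[ \text{(a)}\quad \sum_{n=1}^\infty q^{n}(q^{n+1};q)_\infty (q^{n};q)_{n} = \sum_{n\geq 1}(-1)^{n+1} q^{\frac{3n^2-n}{2}}, \] \[ \text{(b)}\quad \sum_{n=1}^\infty q^{n}(q^{n+1};q)_\infty (-q^{n};q)_{n} = \sum_{n\geq 1}(-1)^{n+1} q^{\frac{3n^2-n}{2}} + 2\sum_{n\geq 0} q^{6n^2+7n+2}. \]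
   Context: Here $q$ is a complex number with $|q|<1$ (equivalently, identities of formal power series in $q$). Notation: $(a;q)_0=1$, $(a;q)_n=\prod_{j=0}^{n-1}(1-aq^j)$, $(a;q)_\infty=\prod_{j=0}^{\infty}(1-aq^j)$. *)

(* Defs.v *)
From HB Require Import structures.
From mathcomp Require Import all_boot all_order all_algebra.
From mathcomp Require Import all_classical all_reals all_analysis.
From mathcomp Require Export complex.

Set Implicit Arguments.
Unset Strict Implicit.
Unset Printing Implicit Defensive.

Import Order.TTheory GRing.Theory Num.Theory numFieldNormedType.Exports.
Local Open Scope classical_set_scope.
Local Open Scope ring_scope.

(* R[i] carries no canonical topology, but every abstract numFieldType does
   (that of its norm): limits are defined over K and then used at K := R[i]. *)

Definition qpoch (K : numFieldType) (a q : K) (n : nat) : K :=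
  \prod_(0 <= j < n) (1 - a * q ^+ j).

(* The product converges whenever `|q| < 1. *)
Definition qpoch_inf (K : numFieldType) (a q : K) : K :=
  limn (fun n => qpoch a q n).

(* limn is total: tsum m u is meaningful only when sum_cvg m u holds. *)
Definition tsum (K : numFieldType) (m : nat) (u : nat -> K) : K :=
  \big[+%R/0]_(m <= n <oo) u n.

Definition sum_cvg (K : numFieldType) (m : nat) (u : nat -> K) : Prop :=
  cvgn (fun N => \sum_(m <= n < N) u n).

Section Series.
Context {K : numFieldType}.
Implicit Type q : K.

Definition Fterm q (n : nat) : K :=
  q ^+ n * qpoch_inf (q ^+ n.+1) q * qpoch (q ^+ n) q n.

Definition Gterm q (n : nat) : K :=
  q ^+ n * qpoch_inf (q ^+ n.+1) q * qpoch (- q ^+ n) q n.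

(* Both nat operations are exact: n <= 3n^2 and 3n^2 - n is even. *)
Definition pentagonal_term q (n : nat) : K :=
  (-1) ^+ n.+1 * q ^+ ((3 * n ^ 2 - n) %/ 2).

Definition theta_term q (n : nat) : K := q ^+ (6 * n ^ 2 + 7 * n + 2).

Definition power_term (a : nat -> int) q (n : nat) : K := (a n)%:~R * q ^+ n.

End Series.

(* Main.v *)
(** Put [t_n(z) = q^n (q^{n+1};q)_oo (z q^n;q)_n] and
    [g_n(z) = (q^{n+1};q)_oo (z q^{n+2};q)_n]. Then [t_0 = g_0] and
    [t_{n+1}(z) + z q^2 t_n(z q^3) = g_{n+1}(z) - g_n(z)], so the partial sums
    satisfy [S_{N+1}(z) = g_N(z) - z q^2 S_N(z q^3)]. Iterating, and using
    [g_n = 1 + O(|q|^n)] uniformly in [|z| <= 1], gives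
      [sum_{n >= 0} t_n(z) = sum_{k >= 0} (-z)^k q^{k(3k+1)/2}].
    At [z = 1] and [z = -1] the terms with [n >= 1] are those of (a) and (b);
    the term [n = 0] is [(q;q)_oo], evaluated by the pentagonal number theorem. *)

Require Import Defs.
From mathcomp Require Import all_boot all_order all_algebra.
From mathcomp Require Import all_classical all_reals all_analysis.
From mathcomp Require Import ring zify.

Set Implicit Arguments.
Unset Strict Implicit.
Unset Printing Implicit Defensive.

Import Order.TTheory GRing.Theory Num.Theory numFieldNormedType.Exports.
Local Open Scope classical_set_scope.
Local Open Scope ring_scope.

(** Taking [u n = r ^+ n] shows that this also implies [r ^+ n --> 0], which is
    not automatic in a [numFieldType]. *)
Definition geom_complete (K : numFieldType) : Prop :=
  forall (u : nat -> K) (C r : K), 0 <= r -> r < 1 ->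
  (forall n, `|u n.+1 - u n| <= C * r ^+ n) -> cvgn u.

(** [n(3n+1)/2], written without division. *)
Definition pent2 n : nat := n * n + 'C(n.+1, 2).

Lemma pent2S n : pent2 n.+1 = (pent2 n + 3 * n + 2)%N.
Proof. by rewrite /pent2 binS bin1; lia. Qed.

Lemma pent2_ge n : (2 * n <= pent2 n)%N.
Proof. by elim: n => // n; rewrite pent2S; lia. Qed.

(** By induction, the product times one minus the sum of the [x j] stays at most 1, and that last
    factor is at least 1/2. *)
Lemma prod1D_le2 (K : numFieldType) (x : nat -> K) n : (forall j, 0 <= x j) ->
  \sum_(0 <= j < n) x j <= 2^-1 -> \prod_(0 <= j < n) (1 + x j) <= 2.
Proof.
move=> x0 xs; have s0 k : 0 <= \sum_(0 <= j < k) x j by apply: sumr_ge0.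
have h k : \prod_(0 <= j < k) (1 + x j) * (1 - \sum_(0 <= j < k) x j) <= 1.
  elim: k => [|k IH]; first by rewrite !big_geq // subr0 mulr1.
  rewrite !big_nat_recr //=; apply: le_trans IH.
  rewrite -mulrA ler_wpM2l ?prodr_ge0 // => [j _|]; first by rewrite addr_ge0.
  rewrite -subr_ge0 [X in 0 <= X](_ : _ = x k * (\sum_(0 <= j < k) x j + x k)); last by ring.
  by rewrite mulr_ge0 ?addr_ge0.
have p0 : 0 <= \prod_(0 <= j < n) (1 + x j) by apply: prodr_ge0 => j _; rewrite addr_ge0.
rewrite -[leLHS]mulr1 -[X in _ * X](@mulVf _ 2) ?pnatr_eq0 // mulrA ler_piMl ?ler0n //.
apply: le_trans (h n); rewrite ler_wpM2l // lerBrDr.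
by apply: le_trans (lerD (lexx _) xs) _; rewrite -mulr2n -[_ *+ 2]mulr_natr mulVf ?pnatr_eq0.
Qed.

Lemma qpoch0 (K : numFieldType) (a q : K) : qpoch a q 0 = 1.
Proof. by rewrite /qpoch big_geq. Qed.

Lemma qpochSr (K : numFieldType) (a q : K) n :
  qpoch a q n.+1 = qpoch a q n * (1 - a * q ^+ n).
Proof. by rewrite /qpoch big_nat_recr. Qed.

Lemma qpochSl (K : numFieldType) (a q : K) n :
  qpoch a q n.+1 = (1 - a) * qpoch (a * q) q n.
Proof.
rewrite /qpoch big_nat_recl //= expr0 mulr1; congr (_ * _).
by apply: eq_bigr => i _; rewrite exprS mulrA.
Qed.

(** * Geometric sums and limits in a numeric field *)

Lemma sum_geom_le (K : numFieldType) (r : K) m M : 0 <= r -> r < 1 ->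
  \sum_(m <= n < M) r ^+ n <= r ^+ m / (1 - r).
Proof.
move=> r0 r1; have r1' : 0 < 1 - r by rewrite subr_gt0.
rewrite ler_pdivlMr // mulr_suml.
have [mM|Mm] := leqP m M; last by rewrite big_geq ?exprn_ge0 // ltnW.
under eq_bigr do rewrite mulrBr mulr1 -exprSr -opprB.
by rewrite sumrN telescope_sumr // opprB gerBl exprn_ge0.
Qed.

Lemma norm_sum_geom_le (K : numFieldType) (u : nat -> K) (C r : K) m M :
  0 <= C -> 0 <= r -> r < 1 -> (forall n, (m <= n < M)%N -> `|u n| <= C * r ^+ n) ->
  `|\sum_(m <= n < M) u n| <= C / (1 - r) * r ^+ m.
Proof.
move=> C0 r0 r1 uC; apply: le_trans (ler_norm_sum _ _ _) _.
apply: (@le_trans _ _ (\sum_(m <= n < M) C * r ^+ n)).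
  by rewrite big_nat [leRHS]big_nat; apply: ler_sum.
by rewrite -mulr_sumr -mulrA [_^-1 * _]mulrC ler_wpM2l // sum_geom_le.
Qed.

Lemma cvg_normP (K : numFieldType) (u : nat -> K) (l : K) :
  (forall e, 0 < e -> \forall n \near \oo, `|l - u n| < e) -> u @ \oo --> l.
Proof. by move=> h; apply/cvgrPdist_lt. Qed.

Lemma cvg_seq_unique (K : numFieldType) (u : nat -> K) (l l' : K) :
  u @ \oo --> l -> u @ \oo --> l' -> l = l'.
Proof. by move=> h h'; apply: (@cvg_unique K (@norm_hausdorff _ K) _ _ _ _ h h'). Qed.

Lemma norm_lim_le (K : numFieldType) (u : nat -> K) (l a B : K) :
  u @ \oo --> l -> (forall n, `|u n - a| <= B) -> `|l - a| <= B.
Proof.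
move=> ul uB; have B0 : 0 <= B by apply: le_trans (uB 0%N).
rewrite real_leNgt ?ger0_real //; apply/negP => lB.
have e0 : 0 < `|l - a| - B by rewrite subr_gt0.
have /cvgrPdist_lt/(_ _ e0)[N _ /(_ N (leqnn N))] := ul.
rewrite /= ltrBrDr; apply/negP; rewrite -real_leNgt ?realD ?ger0_real //.
by apply: le_trans (ler_distD (u N) _ _) _; rewrite lerD2l uB.
Qed.

(** * Convergence from geometric bounds *)

Section Analysis.
Context {K : numFieldType} (Kc : geom_complete K).

(** Completeness provides some limit [l]; shifting the sequence gives [l = r * l], and [r < 1]
    leaves only [l = 0]. *)
Lemma cvg_geom0 (r : K) : 0 <= r -> r < 1 -> (fun n => r ^+ n) @ \oo --> (0 : K).
Proof.
move=> r0 r1; have cr : cvgn (fun n => r ^+ n).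
  apply: (Kc (C := 1 - r) r0 r1) => n.
  rewrite exprSr -{2}[r ^+ n]mulr1 -mulrBr normrM mulrC distrC.
  by rewrite !ger0_norm ?exprn_ge0 ?subr_ge0 // ltW.
have /cvg_ex[l rl] := cr.
suff l0 : l = 0 by rewrite -l0.
have h1 : (fun n => r ^+ n.+1) @ \oo --> l by rewrite cvg_shiftS.
have h2 : (fun n => r ^+ n.+1) @ \oo --> r * l.
  under eq_fun do rewrite exprS.
  exact: cvgMr.
have /eqP : l = r * l by exact: cvg_seq_unique h1 h2.
rewrite -subr_eq0 -{1}[l]mul1r -mulrBl mulf_eq0 subr_eq0 => /orP[/eqP re|/eqP //].
by rewrite -re ltxx in r1.
Qed.

Lemma cvg_geom_bound (u : nat -> K) (l C r : K) : 0 <= r -> r < 1 ->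
  (forall n, `|u n - l| <= C * r ^+ n) -> u @ \oo --> l.
Proof.
move=> r0 r1 uC; apply: cvg_normP => e e0.
have : (fun n => C * r ^+ n) @ \oo --> C * 0 by apply: cvgMr; apply: cvg_geom0.
rewrite mulr0 => /cvgrPdist_lt/(_ _ e0); apply: filterS => n.
rewrite sub0r normrN distrC; apply: le_lt_trans.
by apply: le_trans (uC n) _; rewrite real_ler_norm // ger0_real // (le_trans _ (uC n)).
Qed.

Lemma cvg_series_geom (m : nat) (u : nat -> K) (C r : K) : 0 <= r -> r < 1 ->
  (forall n, `|u n| <= C * r ^+ n) -> sum_cvg m u.
Proof.
move=> r0 r1 uC; apply: (Kc (C := C) r0 r1) => n.
have [mn|nm] := leqP m n; first by rewrite big_nat_recr //= [X in X - _]addrC addrK.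
by rewrite !big_geq ?subrr ?normr0 // ?(le_trans _ (uC n)) // ltnW.
Qed.

(** * Bounds and limits of [q]-Pochhammer products *)

Section Qseries.
Context (q : K) (q1 : `|q| < 1).
Let r : K := `|q|.
Let r0 : 0 <= r. Proof. exact: normr_ge0. Qed.

(** The factors are bounded by [1 + r ^+ j]. With [r ^+ J < (1 - r) / 2], the first [J] of them
    contribute at most [2 ^+ J] and the others at most 2 by [prod1D_le2], since their [r ^+ j] add
    up to at most 1/2. *)
Lemma qpoch_bounded :
  exists2 C, 0 <= C & forall a n, `|a| <= 1 -> `|qpoch a q n| <= C.
Proof.
have e0 : 0 < (1 - r) / 2 by rewrite divr_gt0 ?subr_gt0 ?ltr0n.
have /cvgrPdist_lt/(_ _ e0)[J _ /(_ J (leqnn J))] := cvg_geom0 r0 q1.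
rewrite /= sub0r normrN ger0_norm ?exprn_ge0 // => rJ.
have P j : 0 <= 1 + r ^+ j by rewrite addr_ge0 ?exprn_ge0.
exists (2 ^+ J * 2); first by rewrite mulr_ge0 ?exprn_ge0 ?ler0n.
(* Extra factors, each at least 1, extend the range to [J + n], so that it can be cut at [J] for
   every [n]. *)
move=> a n a1; apply: (@le_trans _ _ (\prod_(0 <= j < J + n) (1 + r ^+ j))).
  rewrite (big_cat_nat (n := n)) ?leq_addl //= normr_prod -[leLHS]mulr1.
  rewrite ler_pM ?prodr_ge0 //.
    apply: ler_prod => j _; rewrite normr_ge0 /=.
    apply: le_trans (ler_normB _ _) _; rewrite normr1 lerD2l normrM normrX.
    by rewrite ler_piMl ?exprn_ge0.
  elim/big_rec: _ => // j x _ x1.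
  by rewrite -[1]mulr1 ler_pM // mulr1 lerDl exprn_ge0.
rewrite (big_cat_nat (n := J)) ?leq_addr //= ler_pM ?prodr_ge0 //.
  rewrite -{2}[J]subn0 -prodr_const_nat; apply: ler_prod => j _; rewrite P /=.
  by rewrite (_ : 2 = 1 + 1) // lerD2l exprn_ile1 // ltW.
rewrite -{1}[J]add0n big_addn addKn; apply: prod1D_le2 => [j|].
  by rewrite exprn_ge0.
under eq_bigr do rewrite exprD.
rewrite -mulr_suml.
apply: le_trans (ler_wpM2r _ (sum_geom_le 0 n r0 q1)) _; first by rewrite exprn_ge0.
by rewrite expr0 mul1r mulrC ler_pdivrMr ?subr_gt0 // mulrC ltW.
Qed.

Lemma cvg_qpoch (a : K) : `|a| <= 1 -> (fun n => qpoch a q n) @ \oo --> qpoch_inf a q.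
Proof.
move=> a1; have [C C0 qC] := qpoch_bounded.
apply: (Kc (C := C) r0 q1) => n.
rewrite qpochSr mulrBr mulr1 [X in X - _]addrC addrK normrN normrM ler_pM ?qC //.
by rewrite normrM normrX ler_piMl ?exprn_ge0.
Qed.

(** Telescoping from [qpoch a q 0 = 1]. A bound linear in [|a|] becomes geometric decay once [a]
    contains a power of [q]. *)
Lemma qpoch_near1 : exists2 C, 0 <= C & forall a n, `|a| <= 1 ->
  `|qpoch a q n - 1| <= C * `|a|.
Proof.
have [C C0 qC] := qpoch_bounded.
exists (C / (1 - r)) => [|a n a1]; first by rewrite divr_ge0 // subr_ge0 ltW.
have -> : qpoch a q n - 1 = \sum_(0 <= j < n) (qpoch a q j.+1 - qpoch a q j).
  by rewrite telescope_sumr // qpoch0.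
have D0 : 0 <= C * `|a| by rewrite mulr_ge0.
rewrite mulrAC -[leRHS]mulr1 -[X in _ * X](expr0 r).
apply: norm_sum_geom_le => // j _.
rewrite qpochSr mulrBr mulr1 [X in X - _]addrC addrK normrN normrM -mulrA.
by rewrite ler_pM ?qC // normrM normrX.
Qed.

Lemma qpoch_inf_near1 : exists2 C, 0 <= C & forall a, `|a| <= 1 ->
  `|qpoch_inf a q - 1| <= C * `|a|.
Proof.
have [C C0 qC] := qpoch_near1; exists C => // a a1.
by apply: norm_lim_le (cvg_qpoch a1) _ => n; apply: qC.
Qed.

Lemma qpoch_infSl (a : K) : `|a| <= 1 ->
  qpoch_inf a q = (1 - a) * qpoch_inf (a * q) q.
Proof.
move=> a1; have aq1 : `|a * q| <= 1 by rewrite normrM mulr_ile1 // ltW.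
have h : (fun n => qpoch a q n.+1) @ \oo --> qpoch_inf a q.
  by rewrite (cvg_shiftS (qpoch a q)); apply: cvg_qpoch.
apply: cvg_seq_unique h _.
have -> : (fun n => qpoch a q n.+1) = (fun n => (1 - a) * qpoch (a * q) q n).
  by apply/funext => n; rewrite qpochSl.
by apply: cvgMr; apply: cvg_qpoch.
Qed.

Lemma normXq_le1 n : `|q ^+ n| <= 1.
Proof. by rewrite normrX exprn_ile1 // ltW. Qed.

(** * The telescoping recurrence and the partial theta expansion *)

Definition qsum_term (z : K) n : K :=
  q ^+ n * qpoch_inf (q ^+ n.+1) q * qpoch (z * q ^+ n) q n.

Definition qsum_cert (z : K) n : K :=
  qpoch_inf (q ^+ n.+1) q * qpoch (z * q ^+ n.+2) q n.

(** Peeling a factor off either end of [qpoch (z * q ^+ n.+2) q n.+1] relates [A] and [B]; once all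
    is expressed through [z], [q], [Q], [I], [A], [B], the two sides differ by [I] times that
    relation. *)
Lemma qsum_cert_telescope z n :
  qsum_term z n.+1 + z * q ^+ 2 * qsum_term (z * q ^+ 3) n =
  qsum_cert z n.+1 - qsum_cert z n.
Proof.
set A := qpoch (z * q ^+ n.+2) q n; set B := qpoch (z * q ^+ n.+3) q n.
set I := qpoch_inf (q ^+ n.+2) q; set Q := q ^+ n.+1.
have AB : A * (1 - z * Q ^+ 2) = (1 - z * q * Q) * B.
  transitivity (qpoch (z * q ^+ n.+2) q n.+1).
    by rewrite qpochSr -mulrA -exprD /Q -exprM; congr (_ * (1 - z * q ^+ _)); lia.
  by rewrite qpochSl -mulrA -exprSr /Q -mulrA -exprS.
have IQ : qpoch_inf Q q = (1 - Q) * I by rewrite qpoch_infSl ?normXq_le1 // -exprSr.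
have -> : qsum_term z n.+1 = Q * I * ((1 - z * Q) * A).
  by rewrite /qsum_term qpochSl -[z * _ * q]mulrA -exprSr.
have -> : z * q ^+ 2 * qsum_term (z * q ^+ 3) n = z * q * Q * (1 - Q) * I * B.
  rewrite /qsum_term -/Q IQ -[z * _ * q ^+ n]mulrA -exprD add3n -/B.
  by have -> : Q = q * q ^+ n; [exact: exprS | ring].
have -> : qsum_cert z n.+1 = I * (B * (1 - z * q * Q ^+ 2)).
  rewrite /qsum_cert qpochSr -/I -/B; congr (_ * (_ * (1 - _))).
  by rewrite -mulrA -exprD -[RHS]mulrA -exprM -exprS; congr (_ * _ ^+ _); lia.
have -> : qsum_cert z n = (1 - Q) * I * A by rewrite -IQ.
apply/eqP; rewrite -subr_eq0; apply/eqP.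
rewrite [LHS](_ : _ = I * (A * (1 - z * Q ^+ 2) - (1 - z * q * Q) * B)); last by ring.
by rewrite AB subrr mulr0.
Qed.

Lemma qsum_rec z N :
  \sum_(0 <= n < N.+1) qsum_term z n =
  qsum_cert z N - z * q ^+ 2 * \sum_(0 <= n < N) qsum_term (z * q ^+ 3) n.
Proof.
rewrite big_nat_recl // mulr_sumr.
have -> : qsum_term z 0 = qsum_cert z 0.
  by rewrite /qsum_term /qsum_cert !qpoch0 expr0 mul1r.
apply/eqP; rewrite eq_sym subr_eq -addrA -big_split /=.
under eq_bigr do rewrite qsum_cert_telescope.
by rewrite telescope_sumr // addrC subrK.
Qed.

Definition ptheta_term (z : K) n : K := (- z) ^+ n * q ^+ pent2 n.

(** This is [qsum_rec] iterated until the sum is empty: each use replaces [z] by [z * q ^+ 3] and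
    shortens the sum by one, and the prefactors accumulate to [ptheta_term]. *)
Lemma qsum_expand z N :
  \sum_(0 <= n < N) qsum_term z n =
  \sum_(0 <= k < N) ptheta_term z k * qsum_cert (z * q ^+ (3 * k)) (N - k.+1).
Proof.
elim: N z => [|N IH] z; first by rewrite !big_geq.
rewrite qsum_rec IH [RHS]big_nat_recl // mulr_sumr -sumrN; congr (_ + _).
  by rewrite /ptheta_term expr0 mul1r expr0 mulr1 subn1 mul1r.
apply: eq_bigr => k _; rewrite subSS.
have -> : z * q ^+ 3 * q ^+ (3 * k) = z * q ^+ (3 * k.+1).
  by rewrite -mulrA -exprD mulnS.
move: (qsum_cert _ _) => G.
rewrite /ptheta_term pent2S; move: (pent2 k) => p.
rewrite [(- z) ^+ _]exprS -(mulNr z (q ^+ 3)) exprMn.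
have -> : q ^+ (p + 3 * k + 2) = q ^+ p * (q ^+ 3) ^+ k * q ^+ 2.
  by rewrite -exprM -!exprD.
ring.
Qed.

(** The rate [2 * n] matters in [cvg_qsum]: one [r ^+ n] makes up for the weak error bound
    [r ^+ (N - n)] of the certificate, the other keeps the sum geometric. *)
Lemma ptheta_le z n : `|z| <= 1 -> `|ptheta_term z n| <= r ^+ (2 * n).
Proof.
move=> z1; rewrite normrM !normrX normrN -[leRHS]mul1r ler_pM ?exprn_ge0 //.
  by rewrite exprn_ile1.
by rewrite ler_wiXn2l ?pent2_ge // ltW.
Qed.

Lemma qsum_cert_near1 : exists2 C, 0 <= C & forall z n, `|z| <= 1 ->
  `|qsum_cert z n - 1| <= C * r ^+ n.
Proof.
have [C C0 qC] := qpoch_near1; have [D D0 qD] := qpoch_inf_near1.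
have [B B0 qB] := qpoch_bounded.
exists (D * B + C) => [|z n z1]; first by rewrite addr_ge0 ?mulr_ge0.
have le1 k : `|z * q ^+ k| <= 1 by rewrite normrM mulr_ile1 ?normXq_le1.
have lek k : `|q ^+ (n + k)| <= r ^+ n.
  by rewrite normrX ler_wiXn2l ?leq_addr // ltW.
rewrite /qsum_cert; set X := qpoch_inf _ _; set Y := qpoch _ _ _.
have -> : X * Y - 1 = (X - 1) * Y + (Y - 1) by ring.
apply: le_trans (ler_normD _ _) _; rewrite [leRHS]mulrDl lerD //.
  rewrite normrM mulrAC ler_pM ?qB //.
  by apply: le_trans (qD _ (normXq_le1 _)) _; rewrite ler_wpM2l // -addn1 lek.
apply: le_trans (qC _ _ (le1 _)) _; rewrite ler_wpM2l // normrM -[leRHS]mul1r.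
by rewrite ler_pM // -addn2 lek.
Qed.

Lemma cvg_ptheta z : `|z| <= 1 -> sum_cvg 0 (ptheta_term z).
Proof.
move=> z1; apply: (cvg_series_geom (C := 1) r0 q1) => n.
rewrite mul1r; apply: le_trans (ptheta_le _ z1) _.
by rewrite ler_wiXn2l ?leq_pmull // ltW.
Qed.

Lemma cvg_qsum z (l : K) : `|z| <= 1 ->
  (fun N => \sum_(0 <= k < N) ptheta_term z k) @ \oo --> l ->
  (fun N => \sum_(0 <= n < N) qsum_term z n) @ \oo --> l.
Proof.
move=> z1 hl; have [C C0 qC] := qsum_cert_near1.
(* With [N.+1] terms, the [k]-th error is at most a constant times [r ^+ (2 * k) * r ^+ (N - k) = r
   ^+ (N + k)], so the total is [O(r ^+ N)]. *)
rewrite -cvg_shiftS; rewrite -cvg_shiftS in hl.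
set S := (fun N => _) in hl; rewrite -[l]addr0.
set u := (X in X @ _ --> _); have -> : u = S \+ (u \- S).
  by apply/funext => n /=; rewrite addrC subrK.
apply: cvgD => //; apply: (cvg_geom_bound (C := C / (1 - r)) r0 q1) => N.
rewrite subr0 /u /S /= qsum_expand -sumrB.
under eq_bigr do rewrite -{2}[ptheta_term _ _]mulr1 -mulrBr.
rewrite mulrAC -[leRHS]mulr1 -[X in _ * X](expr0 r).
apply: norm_sum_geom_le => // [|k /andP[_ kN]]; first by rewrite mulr_ge0 ?exprn_ge0.
have zk : `|z * q ^+ (3 * k)| <= 1 by rewrite normrM mulr_ile1 ?normXq_le1.
rewrite normrM; apply: le_trans (ler_pM _ _ (ptheta_le _ z1) (qC _ _ zk)) _ => //.
rewrite mulrCA -mulrA -!exprD ler_wpM2l //.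
by have -> : (2 * k + (N.+1 - k.+1) = N + k)%N by lia.
Qed.

End Qseries.
End Analysis.

(** [n(3n-1)/2], written without division. *)
Definition pent1 n : nat := n * n + 'C(n, 2).

Lemma pent1_divE n : ((3 * n ^ 2 - n) %/ 2)%N = pent1 n.
Proof.
have h : (2 * 'C(n, 2) + n = n * n)%N by elim: n => // n IH; rewrite binS bin1; lia.
by rewrite /pent1 -mulnn; lia.
Qed.

Lemma pent1_mono : {homo pent1 : m n / (m < n)%N}.
Proof. by apply: homo_ltn => [|n]; [exact: ltn_trans | rewrite /pent1 binS bin1; lia]. Qed.

(** * A finite pentagonal number identity *)

Section Shanks.
Context {K : numFieldType} (q : K).

(** The [qpoch] factor stands for the quotient of [(q;q)_N] by [(q;q)_s], written without
    division. *)
Definition shanks_term N s : K :=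
  (-1) ^+ s * qpoch (q ^+ s.+1) q (N - s) * q ^+ (s * N + 'C(s.+1, 2)).

Lemma pentagonal_termE n : pentagonal_term q n = - ((-1) ^+ n * q ^+ pent1 n).
Proof. by rewrite /pentagonal_term pent1_divE exprS mulN1r mulNr. Qed.

(** Boundary term for telescoping in [s]. At [s = 0] the general formula would vanish too, through
    its factor [1 - q ^+ 0]. *)
Definition shanks_cert N s : K :=
  if s is 0%N then 0
  else (-1) ^+ s * qpoch (q ^+ s) q (N.+1 - s) * q ^+ (s * N.+1 + 'C(s, 2)).

Lemma shanks_term_telescope N s : (s <= N)%N ->
  shanks_term N.+1 s - shanks_term N s = shanks_cert N s.+1 - shanks_cert N s.
Proof.
rewrite /shanks_term /shanks_cert; case: s => [|s] sN.
  rewrite subSS !subn0 qpochSr !mul0n !bin_small // mul1n addn0 !expr0 !expr1 -exprS.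
  by rewrite addn0; ring.
(* This form of [N] removes the truncated subtractions; each exponent then becomes a common [e] plus
   some of [s.+1] and [N'.+1]. *)
have [d ->] : exists d, N = (d + s.+1)%N by exists (N - s.+1)%N; rewrite subnK.
have -> : ((d + s.+1).+1 - s.+1 = d.+1)%N by lia.
have -> : ((d + s.+1).+1 - s.+2 = d)%N by lia.
rewrite addnK [qpoch (q ^+ s.+1) _ _]qpochSl qpochSr -exprSr.
set Q := qpoch _ _ _; set N' := (d + s.+1)%N.
have -> : q ^+ s.+2 * q ^+ d = q ^+ N'.+1 by rewrite -exprD; congr (_ ^+ _); lia.
have -> : (s.+2 * N'.+1 + 'C(s.+2, 2) = s.+1 * N' + 'C(s.+2, 2) + s.+1 + N'.+1)%N by lia.
have -> : (s.+1 * N'.+1 + 'C(s.+2, 2) = s.+1 * N' + 'C(s.+2, 2) + s.+1)%N by lia.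
have -> : (s.+1 * N'.+1 + 'C(s.+1, 2) = s.+1 * N' + 'C(s.+2, 2))%N.
  by rewrite [in RHS]binS bin1; lia.
rewrite [(-1) ^+ s.+2]exprS; move: (s.+1 * N' + _)%N => e.
have -> : q ^+ (e + s.+1 + N'.+1) = q ^+ e * q ^+ s.+1 * q ^+ N'.+1 by rewrite -!exprD.
have -> : q ^+ (e + s.+1) = q ^+ e * q ^+ s.+1 by rewrite -exprD.
ring.
Qed.

(** Shanks' finite form of the pentagonal number theorem: the term [s = 0] on the
    left is [(q;q)_N] and the others are [O(|q|^N)]. *)
Lemma shanks N : \sum_(0 <= s < N.+1) shanks_term N s =
  \sum_(0 <= k < N.+1) ptheta_term q 1 k - \sum_(1 <= k < N.+1) pentagonal_term q k.
Proof.
elim: N => [|N IH].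
  rewrite !big_nat1 big_geq // /shanks_term /ptheta_term qpoch0 /pent2.
  by rewrite !expr0 !mul1r subr0.
rewrite big_nat_recr //= [X in _ = X - _]big_nat_recr //=.
rewrite [X in _ = _ - X]big_nat_recr //=.
have /eqP : \sum_(0 <= s < N.+1) (shanks_term N.+1 s - shanks_term N s) = shanks_cert N N.+1.
  rewrite (@eq_big_nat _ _ _ _ _ _ (fun s => shanks_cert N s.+1 - shanks_cert N s)).
    by rewrite telescope_sumr // subr0.
  by move=> s /andP[_ sN]; rewrite shanks_term_telescope.
rewrite sumrB subr_eq => /eqP ->.
(* The boundary value [shanks_cert N N.+1] is minus the new pentagonal term, and the new last
   summand [shanks_term N.+1 N.+1] is the new [ptheta_term]. *)
rewrite IH /shanks_cert /shanks_term /ptheta_term pentagonal_termE.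
rewrite !subnn !qpoch0 !mulr1 /pent2 /pent1.
ring.
Qed.

End Shanks.

(** A relation that carries convergence and value together; [sum_cvg] and [tsum] are recovered from
    it at the end. *)
Definition has_sum (K : numFieldType) (m : nat) (u : nat -> K) (l : K) : Prop :=
  (fun N => \sum_(m <= n < N) u n) @ \oo --> l.

Lemma cvg_subseq_ge (K : numFieldType) (u : nat -> K) (e : nat -> nat) (l : K) :
  (forall n, (n <= e n)%N) -> u @ \oo --> l -> (fun n => u (e n)) @ \oo --> l.
Proof.
move=> en ul; apply: cvg_normP => eps e0.
have /cvgrPdist_lt/(_ _ e0)[M _ hM] := ul.
by exists M => // n /= Mn; apply: hM; apply: leq_trans Mn (en n).
Qed.

(** * Calculus of convergent sums *)

Section HasSum.
Context {K : numFieldType}.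
Implicit Types (u v : nat -> K) (l : K).

Lemma has_sum_cvg m u l : has_sum m u l -> sum_cvg m u.
Proof. by move=> h; apply/cvg_ex; exists l. Qed.

Lemma has_sum_tsum m u l : has_sum m u l -> tsum m u = l.
Proof. by move=> h; apply/cvg_lim => //; apply: norm_hausdorff. Qed.

Lemma sum_cvgP m u : sum_cvg m u -> exists l, has_sum m u l.
Proof. by move=> /cvg_ex. Qed.

Lemma has_sum0_1 u l : has_sum 0 u l -> has_sum 1 u (l - u 0%N).
Proof.
(* The shift avoids [N = 0], where both sums are empty and the equality below would read
   [0 = - u 0]. *)
move=> h; rewrite /has_sum -cvg_shiftS.
have -> : (fun N => \sum_(1 <= n < N.+1) u n) =
    (fun N => \sum_(0 <= n < N.+1) u n - u 0%N).
  by apply/funext => N; rewrite [in RHS]big_ltn // [X in _ = X - _]addrC addrK.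
apply: cvgB; last exact: cvg_cst.
by rewrite (cvg_shiftS (fun N => \sum_(0 <= n < N) u n)).
Qed.

Lemma has_sumD m u v l l' : has_sum m u l -> has_sum m v l' ->
  has_sum m (fun n => u n + v n) (l + l').
Proof.
move=> hu hv; rewrite /has_sum; under eq_fun do rewrite big_split /=.
exact: cvgD.
Qed.

Lemma has_sumZ m u l (c : K) : has_sum m u l -> has_sum m (fun n => c * u n) (c * l).
Proof.
move=> hu; rewrite /has_sum; under eq_fun do rewrite -mulr_sumr.
exact: cvgMr.
Qed.

Lemma eq_has_sum m u v l : (forall n, (m <= n)%N -> u n = v n) ->
  has_sum m u l -> has_sum m v l.
Proof.
move=> uv; rewrite /has_sum; set f := (X in X @ _ --> _) => hf.
suff <- : f = (fun N => \sum_(m <= n < N) v n) by [].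
by apply/funext => N; apply: eq_big_nat => n /andP[/uv].
Qed.

End HasSum.

(** The exponents are strictly increasing, so [e n = m] forces [n <= m]. *)
Definition coef_of (e : nat -> nat) (a : nat -> int) (m : nat) : int :=
  if [pick n : 'I_m.+1 | e n == m] is Some n then a n else 0.

(** * Sparse series rewritten as power series *)

Section Coef.
Context (e : nat -> nat) (a : nat -> int) (e_mono : {homo e : m n / (m < n)%N}).

Lemma homo_ltn_ge n : (n <= e n)%N.
Proof. by elim: n => // n IH; apply: leq_ltn_trans IH (e_mono (ltnSn n)). Qed.

Lemma coef_of_exponent n : coef_of e a (e n) = a n.
Proof.
rewrite /coef_of; case: pickP => [i /eqP ei|/(_ (inord n))].
  congr a; case: (ltngtP i n) => // /e_mono; rewrite ei ltnn //.
by rewrite inordK ?eqxx // ltnS homo_ltn_ge.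
Qed.

Lemma coef_of0 m : (forall n, e n != m) -> coef_of e a m = 0.
Proof. by move=> em; rewrite /coef_of; case: pickP => // i; rewrite (negbTE (em i)). Qed.

(** Cutting at [e N] works because no exponent lies below [e 0], and the only one from [e N] up to
    but excluding [e N.+1] is [e N]. *)
Lemma sum_power_coef_of (K : numFieldType) (q : K) N :
  \sum_(0 <= m < e N) power_term (coef_of e a) q m =
  \sum_(0 <= n < N) (a n)%:~R * q ^+ e n.
Proof.
elim: N => [|N IH].
  rewrite [RHS]big_geq // big_nat big1 // => m /= me.
  rewrite /power_term coef_of0 ?mul0r // => n; rewrite gtn_eqF //.
  by case: n => // n; apply: ltn_trans me (e_mono (ltn0Sn n)).
have eN := e_mono (ltnSn N).
rewrite [RHS]big_nat_recr //= -IH (big_cat_nat (n := e N)) ?(ltnW eN) //=; congr (_ + _).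
rewrite big_ltn // /power_term coef_of_exponent big_nat big1 ?addr0 // => m /andP[mN mN1].
rewrite coef_of0 ?mul0r // => n.
have [nN|Nn] := leqP n N.
  rewrite ltn_eqF //; apply: leq_ltn_trans mN.
  by move: nN; rewrite leq_eqVlt => /orP[/eqP-> // | /e_mono/ltnW].
rewrite gtn_eqF //; apply: leq_trans mN1 _.
by move: Nn; rewrite leq_eqVlt => /orP[/eqP-> // | /e_mono/ltnW].
Qed.

(** Bounded coefficients make the power series converge; its partial sums along the subsequence
    [e N] are those of the given series, so the limits agree. *)
Lemma has_sum_coef_of (K : numFieldType) (q l : K) : geom_complete K ->
  `|q| < 1 -> (forall n, `|a n| <= 1) ->
  has_sum 0 (fun n => (a n)%:~R * q ^+ e n) l -> has_sum 0 (power_term (coef_of e a) q) l.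
Proof.
move=> Kc q1 a1 hl.
have [|l' hl'] := @sum_cvgP K 0 (power_term (coef_of e a) q).
  apply: (cvg_series_geom Kc (C := 1) (normr_ge0 q) q1) => m.
  rewrite /power_term normrM normrX ler_wpM2r ?exprn_ge0 //.
  rewrite /coef_of; case: pickP => [i _|_]; last by rewrite normr0 ler01.
  by rewrite -intr_norm (ler_int K _ 1).
suff <- : l' = l by [].
apply: (cvg_seq_unique (cvg_subseq_ge homo_ltn_ge hl')).
by under eq_fun do rewrite sum_power_coef_of.
Qed.

End Coef.

Definition theta_exp n : nat := 6 * n ^ 2 + 7 * n + 2.

Lemma theta_exp_mono : {homo theta_exp : m n / (m < n)%N}.
Proof. by apply: homo_ltn => [|n]; [exact: ltn_trans | rewrite /theta_exp -!mulnn; lia]. Qed.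

(** Source of the exponents in (b): they are the odd-index exponents of the partial theta series. *)
Lemma pent2_odd n : pent2 n.*2.+1 = theta_exp n.
Proof.
elim: n => // n IH; rewrite doubleS 2!pent2S IH /theta_exp -!mulnn; lia.
Qed.

(** * Evaluation of both sums and of their coefficients *)

Section Identities.
Context {K : numFieldType} (Kc : geom_complete K).
Context (q : K) (q1 : `|q| < 1).

Let r0 : 0 <= `|q|. Proof. exact: normr_ge0. Qed.

Lemma cvg_pentagonal m : sum_cvg m (pentagonal_term q).
Proof.
apply: (cvg_series_geom Kc (C := 1) r0 q1) => n.
rewrite mul1r pentagonal_termE normrN normrM !normrX normrN normr1 expr1n mul1r.
by rewrite ler_wiXn2l ?(ltW q1) ?(homo_ltn_ge pent1_mono).
Qed.

Lemma cvg_theta : sum_cvg 0 (theta_term q).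
Proof.
apply: (cvg_series_geom Kc (C := 1) r0 q1) => n.
by rewrite mul1r normrX ler_wiXn2l ?(ltW q1) ?(homo_ltn_ge theta_exp_mono).
Qed.

(** Euler's pentagonal number theorem, as the limit of [shanks]. The bilateral sum is split into
    [A], with exponents [k(3k+1)/2] for [k >= 0], and [- P], with exponents [k(3k-1)/2] for
    [k >= 1]. *)
Lemma pentagonal_number (A P : K) : has_sum 0 (ptheta_term q 1) A ->
  has_sum 1 (pentagonal_term q) P -> qpoch_inf q q = A - P.
Proof.
rewrite /has_sum -cvg_shiftS => hA; rewrite -cvg_shiftS => hP.
have [C C0 qC] := qpoch_bounded Kc q1.
have hq : (fun N => qpoch q q N) @ \oo --> qpoch_inf q q by apply: cvg_qpoch => //; exact: ltW.
apply: cvg_seq_unique hq _.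
rewrite -[A - P]addr0.
pose S N := \sum_(0 <= k < N.+1) ptheta_term q 1 k - \sum_(1 <= k < N.+1) pentagonal_term q k.
have -> : (fun N => qpoch q q N) = S \+ ((fun N => qpoch q q N) \- S).
  by apply/funext => N /=; rewrite addrC subrK.
apply: cvgD; first exact: cvgB hA hP.
apply: (cvg_geom_bound Kc (C := C / (1 - `|q|)) r0 q1) => N.
rewrite subr0 /= /S /= -shanks big_ltn // {1}/shanks_term.
rewrite expr0 mul1r mul0n bin_small // expr0 mulr1 expr1 subn0 opprD addrA subrr add0r normrN.
rewrite mulrAC -[leRHS]mulr1.
apply: le_trans (norm_sum_geom_le (C := C * `|q| ^+ N) _ r0 q1 _) _.
- by rewrite mulr_ge0 ?exprn_ge0.
- move=> s /andP[s0 _]; rewrite /shanks_term !normrM !normrX normrN normr1 expr1n mul1r.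
  (* For [s >= 1] the exponent [s * N + 'C(s.+1, 2)] is at least [N + s]. *)
  rewrite -mulrA -exprD ler_pM ?exprn_ge0 ?qC ?normXq_le1 // ler_wiXn2l ?(ltW q1) //.
  by rewrite leq_add ?leq_pmull // binS bin1 leq_addl.
by rewrite expr1 ler_wpM2l ?(ltW q1) // divr_ge0 ?mulr_ge0 ?exprn_ge0 // subr_ge0 ltW.
Qed.

(** Even-index terms cancel and odd-index terms double, hence the even cut-off [N.*2]. *)
Lemma sum_ptheta_diff N :
  \sum_(0 <= k < N.*2) (ptheta_term q (-1) k - ptheta_term q 1 k) =
  2 * \sum_(0 <= n < N) theta_term q n.
Proof.
elim: N => [|N IH]; first by rewrite !big_geq // mulr0.
rewrite doubleS !big_nat_recr //= IH -addrA mulrDr; congr (_ + _).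
have s2 : (-1) ^+ N.*2 = 1 :> K by rewrite -signr_odd odd_double.
rewrite /ptheta_term pent2_odd opprK !expr1n [(-1) ^+ _.+1]exprS s2 /theta_term -/(theta_exp N).
ring.
Qed.

Lemma theta_split (A B T : K) : has_sum 0 (ptheta_term q 1) A ->
  has_sum 0 (ptheta_term q (-1)) B -> has_sum 0 (theta_term q) T -> B - A = 2 * T.
Proof.
move=> hA hB hT.
have hAB : has_sum 0 (fun k => ptheta_term q (-1) k - ptheta_term q 1 k) (B - A).
  by rewrite /has_sum; under eq_fun do rewrite sumrB; apply: cvgB.
have dbl n : (n <= n.*2)%N by rewrite -addnn leq_addr.
apply: (cvg_seq_unique (cvg_subseq_ge dbl hAB)).
under eq_fun do rewrite sum_ptheta_diff.
exact: cvgMr.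
Qed.

(** At [z = 1] the sum from [n = 0] is [A], and its zeroth term [(q;q)_oo] is [A - P]; removing it
    leaves [P]. *)
Lemma has_sum_F (P : K) : has_sum 1 (pentagonal_term q) P -> has_sum 1 (Fterm q) P.
Proof.
move=> hP; have p1 : `|1 : K| <= 1 by rewrite normr1.
have [A hA] := sum_cvgP (cvg_ptheta Kc q1 p1).
have := has_sum0_1 (cvg_qsum Kc q1 p1 hA).
rewrite /qsum_term qpoch0 expr0 mul1r mulr1 expr1 (pentagonal_number hA hP) subKr.
by apply: eq_has_sum => n _; rewrite /Fterm mul1r.
Qed.

(** At [z = -1] the sum from [n = 0] is [B]; removing the same zeroth term leaves [B - (A - P)], and
    [B - A = 2 * T]. *)
Lemma has_sum_G (P T : K) : has_sum 1 (pentagonal_term q) P ->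
  has_sum 0 (theta_term q) T -> has_sum 1 (Gterm q) (P + 2 * T).
Proof.
move=> hP hT; have p1 : `|1 : K| <= 1 by rewrite normr1.
have [A hA] := sum_cvgP (cvg_ptheta Kc q1 p1).
have n1 : `|-1 : K| <= 1 by rewrite normrN normr1.
have [B hB] := sum_cvgP (cvg_ptheta Kc q1 n1).
have := has_sum0_1 (cvg_qsum Kc q1 n1 hB).
rewrite {2}/qsum_term qpoch0 expr0 mul1r mulr1 expr1 (pentagonal_number hA hP).
rewrite opprB addrCA (theta_split hA hB hT).
by apply: eq_has_sum => n _; rewrite /Gterm /qsum_term mulN1r.
Qed.

(** The coefficients are read off from the right-hand sides of (a) and (b). *)
Definition F_coef : nat -> int := coef_of pent1 (fun n => (-1) ^+ n.+1).
Definition G_coef n : int := F_coef n + 2 * coef_of theta_exp (fun=> 1) n.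

Lemma has_sum_F_coef (P : K) : has_sum 1 (pentagonal_term q) P ->
  has_sum 1 (power_term F_coef q) P.
Proof.
move=> hP; have [P0 hP0] := sum_cvgP (cvg_pentagonal (m := 0%N)).
have -> : P = P0 - pentagonal_term q 0 by apply: cvg_seq_unique hP _; apply: has_sum0_1.
(* Since [pent1 0 = 0], both series have the term -1 at index 0, so starting them at 1 drops the
   same amount. *)
have -> : pentagonal_term q 0 = power_term F_coef q 0.
  have F0 : F_coef 0 = -1 by exact: (coef_of_exponent _ pent1_mono 0).
  by rewrite /power_term F0 pentagonal_termE !expr0 mulr1 mulr1.
apply: has_sum0_1; apply: has_sum_coef_of => //.
- exact: pent1_mono.
- by move=> n; rewrite normrX normrN normr1 expr1n.
apply: eq_has_sum hP0 => n _.
by rewrite pentagonal_termE -mulNr exprS mulN1r rmorphN rmorphXn rmorphN1.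
Qed.

Lemma has_sum_theta_coef (T : K) : has_sum 0 (theta_term q) T ->
  has_sum 1 (power_term (coef_of theta_exp (fun=> 1)) q) T.
Proof.
(* All exponents are at least 2, so the coefficient at index 0 vanishes. *)
move=> hT; have -> : T = T - power_term (coef_of theta_exp (fun=> 1)) q 0.
  by rewrite /power_term coef_of0 ?mul0r ?subr0 // => n; rewrite /theta_exp addn2.
apply: has_sum0_1; apply: has_sum_coef_of => //.
- exact: theta_exp_mono.
by apply: eq_has_sum hT => n _; rewrite mul1r.
Qed.

Lemma has_sum_G_coef (P T : K) : has_sum 1 (pentagonal_term q) P ->
  has_sum 0 (theta_term q) T -> has_sum 1 (power_term G_coef q) (P + 2 * T).
Proof.
move=> /has_sum_F_coef hP /has_sum_theta_coef hT.
have := has_sumD hP (has_sumZ (c := 2) hT); apply: eq_has_sum => n _.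
by rewrite /power_term /G_coef intrD intrM; ring.
Qed.

End Identities.

(** * Geometric completeness of the complex numbers *)

Lemma normc_ge_Im (R : rcfType) (x : R[i]) : `|complex.Im x|%:C%C <= `|x|.
Proof.
by case: x => a b; rewrite normc_def lecR /= -sqrtr_sqr ler_wsqrtr // lerDr sqr_ge0.
Qed.

Lemma normc_le (R : rcfType) (x : R[i]) :
  `|x| <= (`|complex.Re x| + `|complex.Im x|)%:C%C.
Proof.
case: x => a b; rewrite normc_def lecR /= -[leRHS]ger0_norm ?addr_ge0 //.
rewrite -[leRHS]sqrtr_sqr ler_wsqrtr // sqrrD !real_normK ?num_real //.
by rewrite lerD2r lerDl mulrn_wge0 // mulr_ge0.
Qed.

(** Real and imaginary parts inherit the bound on increments, converge by comparison with a real
    geometric series, and are recombined through [normc_le]. *)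
Lemma geom_complete_complex (R : realType) : geom_complete R[i].
Proof.
move=> u C r r0 r1 uC.
have C0 : 0 <= C by have := le_trans (normr_ge0 _) (uC 0%N); rewrite expr0 mulr1.
have /complex_realP[c Cc] := ger0_real C0; have /complex_realP[s rs] := ger0_real r0.
move: r0 r1 C0; rewrite rs Cc (lecR 0) (ltcR _ 1) (lecR 0) => s0 s1 c0.
have cvgR (v : nat -> R) : (forall n, `|v n.+1 - v n| <= c * s ^+ n) -> cvgn v.
  move=> vC; have : cvgn (series (fun n => v n.+1 - v n)).
    apply: normed_cvg; apply: (@series_le_cvg _ _ (geometric c s)) => [n|n|n|].
    - exact: normr_ge0.
    - by rewrite /= mulr_ge0 ?exprn_ge0.
    - exact: vC.
    by apply: is_cvg_geometric_series; rewrite ger0_norm.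
  have -> : series (fun n => v n.+1 - v n) = (fun n => v n - v 0%N).
    by apply/funext => n; rewrite /series /= telescope_sumr.
  move=> cv; have -> : v = (fun n => (v n - v 0%N) + v 0%N).
    by apply/funext => n; rewrite subrK.
  by apply: is_cvgD => //; apply: is_cvg_cst.
have uCn n : `|u n.+1 - u n| <= (c * s ^+ n)%:C%C.
  by move: (uC n); rewrite Cc rs -rmorphXn -rmorphM.
have /cvgR/cvg_ex[a ha] : forall n, `|complex.Re (u n.+1) - complex.Re (u n)| <= c * s ^+ n.
  move=> n; rewrite -raddfB -lecR; apply: le_trans (uCn n); exact: normc_ge_Re.
have /cvgR/cvg_ex[b hb] : forall n, `|complex.Im (u n.+1) - complex.Im (u n)| <= c * s ^+ n.
  move=> n; rewrite -raddfB -lecR; apply: le_trans (uCn n); exact: normc_ge_Im.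
apply/cvg_ex; exists (a +i* b)%C; apply: cvg_normP => e e0.
have /complex_realP[d de] := gtr0_real e0.
move: e0; rewrite de (ltcR 0) => d0; have d2 : 0 < d / 2 by rewrite divr_gt0.
move/cvgrPdist_lt/(_ _ d2): ha => ha; move/cvgrPdist_lt/(_ _ d2): hb => hb.
apply: filterS2 ha hb => n ha hb; apply: le_lt_trans (normc_le _) _.
by rewrite ltcR [d]splitr !raddfB; apply: ltrD.
Qed.

Theorem theorem1p1 (R : realType) :
  exists F' G' : nat -> int, forall q : R[i], `|q| < 1 ->
  [/\ [/\ sum_cvg 1 (Fterm q), sum_cvg 1 (power_term F' q)
        & tsum 1 (power_term F' q) = tsum 1 (Fterm q)],
      [/\ sum_cvg 1 (Gterm q), sum_cvg 1 (power_term G' q)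
        & tsum 1 (power_term G' q) = tsum 1 (Gterm q)],
      sum_cvg 1 (pentagonal_term q) /\
      tsum 1 (Fterm q) = tsum 1 (pentagonal_term q)
    & sum_cvg 0 (theta_term q) /\
      tsum 1 (Gterm q) = tsum 1 (pentagonal_term q) + 2 * tsum 0 (theta_term q)].
Proof.
exists F_coef, G_coef => q q1; have Kc := @geom_complete_complex R.
have [P hP] := sum_cvgP (cvg_pentagonal Kc q1 (m := 1%N)).
have [T hT] := sum_cvgP (cvg_theta Kc q1).
have hF := has_sum_F Kc q1 hP; have hG := has_sum_G Kc q1 hP hT.
have hF' := has_sum_F_coef Kc q1 hP; have hG' := has_sum_G_coef Kc q1 hP hT.
rewrite (has_sum_tsum hP) (has_sum_tsum hT) (has_sum_tsum hF) (has_sum_tsum hG).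
rewrite (has_sum_tsum hF') (has_sum_tsum hG').
split; split; [exact: has_sum_cvg hF | exact: has_sum_cvg hF' | reflexivity |
  exact: has_sum_cvg hG | exact: has_sum_cvg hG' | reflexivity |
  exact: has_sum_cvg hP | reflexivity | exact: has_sum_cvg hT | reflexivity].
Qed.
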